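(* Let $n\ge2$, $1<\mathscr{P}\le n-1$, $N=\binom{n}{\mathscr{P}}$, let $0\le l<k\le N$ be integers and $p,q$ constants with $p=q-l>1$, and let $\varepsilon>0$. Let $\varphi\in C^0(\mathbb{S}^n)$ be positive and let $u\in C^2(\mathbb{S}^n)$ be a positive admissible solution of $$\frac{\sigma_k(\Lambda(\nabla^2u+uI))}{\sigma_l(\Lambda(\nabla^2u+uI))}=u^{p-1+\varepsilon}(u^2+|\nabla u|^2)^{\frac{k+1-q}{2}}\varphi\quad\text{on }\mathbb{S}^n.$$ Then for all $x\in\mathbb{S}^n$, $$\frac{\binom{N}{k}}{\binom{N}{l}}\frac{\mathscr{P}^{k-l}}{\max_{\mathbb{S}^n}\varphi}\le u^{\varepsilon}(x)\le\frac{\binom{N}{k}}{\binom{N}{l}}\frac{\mathscr{P}^{k-l}}{\min_{\mathbb{S}^n}\varphi}.$$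
   Context: $\mathbb{S}^n$ is the unit sphere with its standard metric; $\nabla u$, $\nabla^2u$ are the gradient and covariant Hessian in a local orthonormal frame; $I$ is the identity. Let $\mathbf{I}_1,\dots,\mathbf{I}_N$ enumerate the multi-indices $1\le i_1<\dots<i_{\mathscr{P}}\le n$. For a symmetric matrix $A$ with eigenvalues $\lambda$, $\Lambda(A)=(\Lambda_{\mathbf{I}_1},\dots,\Lambda_{\mathbf{I}_N})$ with $\Lambda_{\mathbf{I}}=\lambda_{i_1}+\dots+\lambda_{i_{\mathscr{P}}}$. $\sigma_m$ is the $m$-th elementary symmetric polynomial, $\sigma_0=1$; $\Gamma_k=\{\mu\in\mathbb{R}^N:\sigma_j(\mu)>0,\ 1\le j\le k\}$. A function $u\in C^2(\mathbb{S}^n)$ is admissible if $\Lambda(\nabla^2u+uI)\in\Gamma_k$ at every point. *)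

(* Defs.v *)
From HB Require Import structures.
From mathcomp Require Import all_boot all_order all_algebra.
From mathcomp Require Import all_classical all_reals all_analysis.
Set Implicit Arguments. Unset Strict Implicit. Unset Printing Implicit Defensive.
Import Order.TTheory GRing.Theory Num.Theory.
Import numFieldNormedType.Exports.
Local Open Scope classical_set_scope.
Local Open Scope ring_scope.

Section Defs.
Variable R : realType.

Definition enorm (m : nat) (y : 'rV[R]_m) : R := Num.sqrt (\sum_i y 0 i ^+ 2).

Definition sphere (n : nat) : set 'rV[R]_(n.+1) :=
  [set x | \sum_i x 0 i ^+ 2 = 1].

Arguments sphere : clear implicits.
Definition ebase (m : nat) (i : 'I_m) : 'rV[R]_m := delta_mx 0 i.

Definition ext0 (n : nat) (u : 'rV[R]_(n.+1) -> R) : 'rV[R]_(n.+1) -> R :=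
  fun y => u ((enorm y)^-1 *: y).

Definition partial (m : nat) (f : 'rV[R]_m -> R) (i : 'I_m) : 'rV[R]_m -> R :=
  fun y => derive f y (ebase i).

Definition egrad (m : nat) (f : 'rV[R]_m -> R) (y : 'rV[R]_m) : 'rV[R]_m :=
  \row_i partial f i y.

Definition ehess (m : nat) (f : 'rV[R]_m -> R) (y : 'rV[R]_m) : 'M[R]_m :=
  \matrix_(i, j) partial (partial f i) j y.

Definition C2_sphere (n : nat) (u : 'rV[R]_(n.+1) -> R) : Prop :=
  forall y : 'rV[R]_(n.+1), y != 0 ->
    [/\ differentiable (ext0 u) y,
        (forall i, differentiable (partial (ext0 u) i) y) &
        (forall i j, {for y, continuous (partial (partial (ext0 u) i) j)})].

Definition tangent_frame (n : nat) (x : 'rV[R]_(n.+1)) (E : 'M[R]_(n, n.+1)) :=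
  E *m E^T = 1%:M /\ E *m x^T = 0.

Definition sgrad (n : nat) (u : 'rV[R]_(n.+1) -> R) (x : 'rV[R]_(n.+1))
  (E : 'M[R]_(n, n.+1)) : 'rV[R]_n := egrad (ext0 u) x *m E^T.

(* covariant Hessian of u at x in the frame E.  Since ext0 u is homogeneous
   of degree 0, its radial derivative vanishes, so the Gauss-formula
   correction term vanishes and nabla^2 u(e_a,e_b) = D^2(ext0 u)(e_a,e_b). *)
Definition shess (n : nat) (u : 'rV[R]_(n.+1) -> R) (x : 'rV[R]_(n.+1))
  (E : 'M[R]_(n, n.+1)) : 'M[R]_n := E *m ehess (ext0 u) x *m E^T.

Definition eigvals_of (n : nat) (A : 'M[R]_n) (lam : 'rV[R]_n) : Prop :=
  exists Q : 'M[R]_n, Q *m Q^T = 1%:M /\ A = Q^T *m diag_mx lam *m Q.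

(* index set of Lambda: the multi-indices i_1 < ... < i_P, i.e. P-subsets *)
Definition Pindices (n P : nat) : {set {set 'I_n}} := [set I : {set 'I_n} | #|I| == P].

Definition LambdaI (n : nat) (lam : 'rV[R]_n) (I : {set 'I_n}) : R :=
  \sum_(i in I) lam 0 i.

Definition sigma (T : finType) (A : {set T}) (m : nat) (f : T -> R) : R :=
  \sum_(S in powerset A | #|S| == m) \prod_(t in S) f t.

Definition sigmaL (n P m : nat) (lam : 'rV[R]_n) : R :=
  sigma (Pindices n P) m (LambdaI lam).

Definition inGamma (n P k : nat) (lam : 'rV[R]_n) : Prop :=
  forall j : nat, (1 <= j <= k)%N -> 0 < sigmaL P j lam.

Definition admissible (n P k : nat) (u : 'rV[R]_(n.+1) -> R) : Prop :=
  forall x, sphere n x -> forall E, tangent_frame x E ->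
  forall lam, eigvals_of (shess u x E + (u x)%:M) lam -> inGamma P k lam.

End Defs.
Arguments sphere {R} n.
Arguments sigmaL {R n} P m lam.
Arguments inGamma {R n} P k lam.
Arguments admissible {R} n P k u.

(* Main.v *)
(** At a maximum point of [u] on the sphere the gradient vanishes and the
    covariant Hessian is nonpositive, so all eigenvalues of [nabla^2 u + u I]
    are at most [u] and all [Lambda_I] are at most [P u].  For [mu] in
    [Gamma_k] with entries at most [c], summing [mu_i sigma_j(mu|i)] over [i]
    gives [(j+1) sigma_{j+1} <= c (N-j) sigma_j] as soon as the truncated
    [sigma_j(mu|i)] are positive, which follows from the Newton-type inequality
    [sigma_{j-1} sigma_{j+1} <= sigma_j^2].  Hence [sigma_k / sigma_l] is at most
    its value at [(c,...,c)], and since [p - 1 + k + 1 - q = k - l] the equation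
    reduces at that point to the upper bound.  A minimum point gives the lower
    bound in the same way, all entries then being positive.  The eigenvalues exist
    because the Hessian is symmetric (Schwarz) and a real symmetric matrix is
    orthogonally diagonalizable. *)
Require Import Defs.
From HB Require Import structures.
From mathcomp Require Import all_boot all_order all_algebra.
From mathcomp Require Import all_classical all_reals all_analysis.
From mathcomp Require Import ring lra.
Import Order.TTheory GRing.Theory Num.Theory.
Import numFieldNormedType.Exports.
Local Open Scope classical_set_scope.
Local Open Scope ring_scope.

(** * Elementary symmetric polynomials over finite sets and bounds for their quotients *)

Section ElementarySymmetric.
Set Implicit Arguments. Unset Strict Implicit.
Context {R : realType} {T : finType}.
Implicit Types (A : {set T}) (f : T -> R).

Lemma sigma_0 A f : sigma A 0 f = 1.
Proof.
rewrite /sigma (big_pred1 finset.set0) ?big_set0// => S /=.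
by rewrite powersetE cards_eq0; case: eqP => [->|_]; rewrite ?finset.sub0set ?andbF.
Qed.

Lemma sigma_notin A f i m :
  \sum_(S in powerset A | (#|S| == m) && (i \notin S)) \prod_(t in S) f t =
  sigma (A :\ i)%SET m f.
Proof.
apply: eq_bigl => S; rewrite !powersetE subsetD1.
by case: (S \subset A); case: (i \in S); case: (#|S| == m).
Qed.

Lemma sigma_in A f i m : i \in A ->
  \sum_(S in powerset A | (#|S| == m.+1) && (i \in S)) \prod_(t in S) f t =
  f i * sigma (A :\ i)%SET m f.
Proof.
move=> iA; rewrite /sigma big_distrr /=.
rewrite (reindex_onto (fun S => i |: S)%SET (fun S => S :\ i)%SET) /=; last first.
  by move=> S /and3P[_ _ iS]; rewrite finset.setD1K.
have iN (S : {set T}) : ((i |: S) :\ i == S)%SET = (i \notin S).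
  apply/eqP/idP => [<-|]; first by rewrite !inE eqxx.
  exact: finset.setU1K.
apply: eq_big => [S|S].
  rewrite !powersetE finset.subUset finset.sub1set iA /= subsetD1 setU11 andbT iN cardsU1.
  by case: (i \in S); rewrite ?andbF ?andbT.
rewrite iN => /andP[_ iS]; rewrite (big_setD1 i) ?setU11//=.
by rewrite finset.setU1K.
Qed.

Lemma sigma_setD1 A f i m : i \in A ->
  sigma A m.+1 f = f i * sigma (A :\ i)%SET m f + sigma (A :\ i)%SET m.+1 f.
Proof.
move=> iA; rewrite {1}/sigma (bigID (fun S : {set T} => i \in S)) /=.
by congr (_ + _); under eq_bigl do rewrite -andbA; rewrite ?sigma_in// sigma_notin.
Qed.

(** Double counting: the monomial of each [S] of size [m + 1] arises once for every [i] in [S]. *)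
Lemma sum_mul_sigma_setD1 A f m :
  \sum_(i in A) f i * sigma (A :\ i)%SET m f = m.+1%:R * sigma A m.+1 f.
Proof.
under eq_bigr => i iA do rewrite -sigma_in//.
rewrite (exchange_big_dep (fun S => (S \in powerset A) && (#|S| == m.+1))) /=; last first.
  by move=> i S _ /and3P[-> ->].
rewrite /sigma big_distrr /=; apply: eq_bigr => S /andP[SA /eqP Sm].
rewrite SA Sm eqxx /=; rewrite powersetE in SA.
under eq_bigl => i.
  rewrite (_ : _ && _ = (i \in S)); last first.
    by case iS: (i \in S); rewrite ?andbF// (fintype.subsetP SA).
  over.
by rewrite sumr_const Sm mulr_natl.
Qed.

(** A set of size [m] survives the deletion of each of the [#|A| - m] indices outside it. The
    difference is taken in [R]; for [m > #|A|] both sides are zero. *)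
Lemma sum_sigma_setD1 A f m :
  \sum_(i in A) sigma (A :\ i)%SET m f = (#|A|%:R - m%:R) * sigma A m f.
Proof.
case: m => [|m].
  under eq_bigr do rewrite sigma_0.
  by rewrite sumr_const sigma_0 mulr1 subr0.
have E i : i \in A ->
    sigma (A :\ i)%SET m.+1 f = sigma A m.+1 f - f i * sigma (A :\ i)%SET m f.
  by move=> iA; rewrite (sigma_setD1 _ _ iA); ring.
rewrite (eq_bigr _ E) sumrB sumr_const sum_mul_sigma_setD1 mulrBl.
by rewrite -[X in X - _]mulr_natl.
Qed.

(* With D_j := sigma_j^2 - sigma_(j-1) sigma_(j+1), the induction rests on
   (j + 1) D_j(A) = sigma_j(A)^2 + \sum_(i in A) f_i^2 D_(j-1)(A \ i). *)
Lemma sigma_newton A f m :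
  sigma A m f * sigma A m.+2 f <= sigma A m.+1 f ^+ 2.
Proof.
elim: m A => [|m IH] A.
  have E : \sum_(i in A) f i ^+ 2 = sigma A 1 f ^+ 2 - 2 * sigma A 2 f.
    have -> : \sum_(i in A) f i ^+ 2 =
        \sum_(i in A) (f i * sigma A 1 f - f i * sigma (A :\ i)%SET 1 f).
      apply: eq_bigr => i iA; rewrite (sigma_setD1 _ _ iA) sigma_0; ring.
    rewrite sumrB sum_mul_sigma_setD1 -mulr_suml expr2; congr (_ * _ - _).
    have := sum_mul_sigma_setD1 A f 0; rewrite mul1r => <-.
    by apply: eq_bigr => i _; rewrite sigma_0 mulr1.
  have : 0 <= \sum_(i in A) f i ^+ 2 by apply: sumr_ge0 => i _; exact: sqr_ge0.
  rewrite E sigma_0 mul1r; have := sqr_ge0 (sigma A 1 f); lra.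
have E : \sum_(i in A) f i ^+ 2 * (sigma (A :\ i)%SET m.+1 f ^+ 2
           - sigma (A :\ i)%SET m f * sigma (A :\ i)%SET m.+2 f) =
    m.+2%:R * sigma A m.+2 f ^+ 2 - m.+3%:R * (sigma A m.+1 f * sigma A m.+3 f).
  transitivity (\sum_(i in A)
      (f i * sigma (A :\ i)%SET m.+1 f * sigma A m.+2 f
       - f i * sigma (A :\ i)%SET m.+2 f * sigma A m.+1 f)).
    by apply: eq_bigr => i iA; rewrite !(sigma_setD1 _ _ iA); ring.
  rewrite sumrB -!mulr_suml !sum_mul_sigma_setD1; ring.
have : 0 <= \sum_(i in A) f i ^+ 2 * (sigma (A :\ i)%SET m.+1 f ^+ 2
           - sigma (A :\ i)%SET m f * sigma (A :\ i)%SET m.+2 f).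
  by apply: sumr_ge0 => i _; rewrite mulr_ge0 ?sqr_ge0// subr_ge0.
rewrite E => h; rewrite -(ler_pM2l (ltr0Sn R m.+2)); move: h.
have -> : m.+3%:R = m.+2%:R + 1 :> R by rewrite natr1.
have := sqr_ge0 (sigma A m.+2 f).
move: m.+2%:R (sigma A m.+2 f ^+ 2) (sigma A m.+1 f * _) => x y z; lra.
Qed.

(** Induction on [j]. Let [a], [b], [c] be the truncated polynomials of orders [j], [j + 1], [j + 2]
    and [t = f i], so that [a], [t a + b] and [t b + c] are positive. Newton's inequality
    [a c <= b^2] yields [0 < a (t b + c) <= b (t a + b)], which forces [b > 0]. *)
Lemma sigma_setD1_gt0 A f i k : i \in A ->
  (forall j, (1 <= j <= k.+1)%N -> 0 < sigma A j f) ->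
  forall j, (j <= k)%N -> 0 < sigma (A :\ i)%SET j f.
Proof.
move=> iA Apos; elim=> [|j IH] jk; first by rewrite sigma_0.
have s0 := IH (ltnW jk).
have /Apos : (1 <= j.+1 <= k.+1)%N by exact: ltnW jk.
rewrite (sigma_setD1 _ _ iA) => s1.
have /Apos : (1 <= j.+2 <= k.+1)%N by [].
rewrite (sigma_setD1 _ _ iA) => s2.
have := sigma_newton (A :\ i)%SET f j.
move: s0 s1 s2; move: (sigma _ j f) (sigma _ j.+1 f) (sigma _ j.+2 f) (f i).
move=> a b c t a0 h1 h2 N; rewrite ltNge; apply/negP => b0.
have tb : - b * b <= t * a * - b by nra.
nra.
Qed.

Lemma sigma_ratio_le A f c k : (forall i, i \in A -> f i <= c) ->
  (forall j, (1 <= j <= k)%N -> 0 < sigma A j f) ->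
  forall j, (j < k)%N ->
  j.+1%:R * sigma A j.+1 f <= c * ((#|A|%:R - j%:R) * sigma A j f).
Proof.
case: k => [//|k] fc Apos j jk; rewrite -sum_mul_sigma_setD1 -sum_sigma_setD1.
rewrite mulr_sumr; apply: ler_sum => i iA; apply: ler_wpM2r (fc i iA).
exact/ltW/(sigma_setD1_gt0 iA Apos).
Qed.

Lemma sigma_ge0 A f m : (forall i, i \in A -> 0 <= f i) -> 0 <= sigma A m f.
Proof.
move=> f0; apply: sumr_ge0 => S /andP[]; rewrite powersetE => /fintype.subsetP SA _.
by apply: prodr_ge0 => i /SA; apply: f0.
Qed.

(** Entries bounded below by [c >= 0] make every truncated polynomial nonnegative, so [f i] can be
    replaced by [c] term by term. *)
Lemma sigma_ratio_ge A f c : 0 <= c -> (forall i, i \in A -> c <= f i) ->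
  forall j, c * ((#|A|%:R - j%:R) * sigma A j f) <= j.+1%:R * sigma A j.+1 f.
Proof.
move=> c0 fc j; rewrite -sum_mul_sigma_setD1 -sum_sigma_setD1.
rewrite mulr_sumr; apply: ler_sum => i iA; apply: ler_wpM2r (fc i iA).
by apply: sigma_ge0 => t; rewrite !inE => /andP[_ /fc]; apply: le_trans.
Qed.

(** For the constant vector [(c, ..., c)] one has [sigma_j = 'C(N, j) c^j]; this recursion says that
    it attains equality in both ratio estimates. *)
Lemma natr_bin_step (N j : nat) :
  j.+1%:R * 'C(N, j.+1)%:R = (N%:R - j%:R) * 'C(N, j)%:R :> R.
Proof.
have [jN|Nj] := leqP j N.
  by rewrite -natrB// -!natrM mul_bin_left.
by rewrite !bin_small// ?mulr0// (ltn_trans Nj).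
Qed.

Lemma sigma_quotient_le A f c k l : 0 <= c -> (l < k)%N -> (k <= #|A|)%N ->
  (forall i, i \in A -> f i <= c) ->
  (forall j, (1 <= j <= k)%N -> 0 < sigma A j f) ->
  sigma A k f / sigma A l f <= 'C(#|A|, k)%:R / 'C(#|A|, l)%:R * c ^+ (k - l).
Proof.
move=> c0 lk kA fc Apos.
have pos j : (j <= k)%N -> 0 < sigma A j f.
  by case: j => [|j] jk; [rewrite sigma_0 | exact: Apos].
have Cpos j : (j <= k)%N -> 0 < 'C(#|A|, j)%:R :> R.
  by move=> jk; rewrite ltr0n bin_gt0 (leq_trans jk).
(* With denominators cleared, the one-step ratio estimate is iterated from [l] up to [l + d]. *)
have step d : (l + d <= k)%N -> sigma A (l + d) f * 'C(#|A|, l)%:R <=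
    'C(#|A|, l + d)%:R * c ^+ d * sigma A l f.
  elim: d => [|d IH] ldk; first by rewrite addn0 expr0 mulr1 mulrC.
  have {}ldk : (l + d < k)%N by rewrite -addnS.
  have := ler_wpM2r (ltW (Cpos l (ltnW lk))) (sigma_ratio_le fc Apos ldk).
  have Nld : 0 <= #|A|%:R - (l + d)%:R :> R.
    by rewrite subr_ge0 ler_nat (leq_trans (ltnW ldk)).
  have := ler_wpM2l (mulr_ge0 c0 Nld) (IH (ltnW ldk)).
  move=> h1 h2; rewrite addnS -(ler_pM2l (ltr0Sn R (l + d))) exprS !mulrA natr_bin_step.
  move: h1 h2; rewrite !mulrA; lra.
have := step (k - l)%N; rewrite subnKC ?(ltnW lk)// => /(_ (leqnn k)) h.
rewrite ler_pdivrMr ?pos ?(ltnW lk)//.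
rewrite -(ler_pM2r (Cpos l (ltnW lk))); apply: le_trans h _.
rewrite le_eqVlt; apply/orP; left; apply/eqP.
by field; rewrite gt_eqF ?Cpos// ltnW.
Qed.

Lemma sigma_quotient_ge A f c k l : 0 <= c -> (l < k)%N -> (k <= #|A|)%N ->
  (forall i, i \in A -> c <= f i) -> 0 < sigma A l f ->
  'C(#|A|, k)%:R / 'C(#|A|, l)%:R * c ^+ (k - l) <= sigma A k f / sigma A l f.
Proof.
move=> c0 lk kA fc pos.
have Cpos j : (j <= k)%N -> 0 < 'C(#|A|, j)%:R :> R.
  by move=> jk; rewrite ltr0n bin_gt0 (leq_trans jk).
have step d : (l + d <= k)%N -> 'C(#|A|, l + d)%:R * c ^+ d * sigma A l f <=
    sigma A (l + d) f * 'C(#|A|, l)%:R.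
  elim: d => [|d IH] ldk; first by rewrite addn0 expr0 mulr1 mulrC.
  have {}ldk : (l + d < k)%N by rewrite -addnS.
  have := ler_wpM2r (ltW (Cpos l (ltnW lk))) (sigma_ratio_ge c0 fc (l + d)).
  have Nld : 0 <= #|A|%:R - (l + d)%:R :> R.
    by rewrite subr_ge0 ler_nat (leq_trans (ltnW ldk)).
  have := ler_wpM2l (mulr_ge0 c0 Nld) (IH (ltnW ldk)).
  move=> h1 h2; rewrite addnS -(ler_pM2l (ltr0Sn R (l + d))) exprS !mulrA natr_bin_step.
  move: h1 h2; rewrite !mulrA; lra.
have := step (k - l)%N; rewrite subnKC ?(ltnW lk)// => /(_ (leqnn k)) h.
rewrite ler_pdivlMr//.
rewrite -(ler_pM2r (Cpos l (ltnW lk))); apply: le_trans _ h.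
rewrite le_eqVlt; apply/orP; left; apply/eqP.
by field; rewrite gt_eqF ?Cpos// ltnW.
Qed.

End ElementarySymmetric.

(** * Tangent frames and orthogonal diagonalization of real symmetric matrices *)

Section RealSpectral.
Set Implicit Arguments. Unset Strict Implicit.
Context {R : realType}.

Lemma mulmx_tr_sqr m (x : 'rV[R]_m) : (x *m x^T) 0 0 = \sum_i x 0 i ^+ 2.
Proof. by rewrite mxE; apply: eq_bigr => i _; rewrite mxE expr2. Qed.

Lemma trmx11 (M : 'M[R]_1) : M^T = M.
Proof. by rewrite [M]mx11_scalar tr_scalar_mx. Qed.

Lemma mxE_sub (M N : 'M[R]_1) : (M - N) 0 0 = M 0 0 - N 0 0.
Proof. by rewrite !mxE. Qed.

Lemma mxE_scale (c : R) (M : 'M[R]_1) : (c *: M) 0 0 = c * M 0 0.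
Proof. by rewrite mxE. Qed.

Lemma sphereP n (x : 'rV[R]_n.+1) : sphere n x <-> x *m x^T = 1%:M.
Proof.
split=> [xS|xx]; last by rewrite /sphere /= -mulmx_tr_sqr xx mxE.
by rewrite [LHS]mx11_scalar mulmx_tr_sqr xS.
Qed.

Lemma sqr_sum_gt0 m (x : 'rV[R]_m) : x != 0 -> 0 < \sum_i x 0 i ^+ 2.
Proof.
move=> x0; rewrite lt_neqAle sumr_ge0 ?andbT; last by move=> i _; exact: sqr_ge0.
apply: contra x0 => /eqP/esym/eqP; rewrite psumr_eq0; last by move=> i _; exact: sqr_ge0.
move=> /allP h; apply/eqP/rowP => i; rewrite mxE; apply/eqP.
by have := h i (mem_index_enum _); rewrite sqrf_eq0.
Qed.

Lemma continuous_quadratic m (A : 'M[R]_m) :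
  continuous (fun y : 'rV[R]_m => (y *m A *m y^T) 0 0).
Proof.
rewrite (_ : (fun _ => _) = fun y : 'rV[R]_m =>
    \sum_i (\sum_j y 0 j * A j i) * y 0 i); last first.
  by apply/funext => y; rewrite mxE; apply: eq_bigr => i _; rewrite !mxE.
have ct i : continuous (fun y : 'rV[R]_m => \sum_j y 0 j * A j i).
  apply: continuous_big; first exact: add_continuous.
  by move=> j _ y; apply: continuousM; [exact: coord_continuous | exact: cst_continuous].
apply: continuous_big; first exact: add_continuous.
by move=> i _ y; apply: continuousM; [exact: ct | exact: coord_continuous].
Qed.

Lemma sphere_compact n : compact (@sphere R n).
Proof.
apply: (@subclosed_compact _ _ [set v : 'rV[R]_n.+1 |
    forall i, `[-1, 1]%classic (v ord0 i)]).
- rewrite (_ : sphere n = (fun y : 'rV[R]_n.+1 => (y *m 1%:M *m y^T) 0 0) @^-1` [set 1]).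
    apply: preimage_closed; last exact: closed_eq.
    by move=> x _; exact: continuous_quadratic.
  by apply/seteqP; split=> x /=; rewrite mulmx1 mulmx_tr_sqr.
- apply: (@rV_compact R n.+1 (fun=> `[-1, 1]%classic)) => _.
  exact: segment_compact.
- move=> x xS i; rewrite /= in_itv /= -ler_norml.
  rewrite -(ler_pXn2r (ltn0Sn 1)) ?nnegrE// expr1n -normrX ger0_norm ?sqr_ge0//.
  rewrite -xS (bigD1 i)//= lerDl; apply: sumr_ge0 => j _; exact: sqr_ge0.
Qed.

Lemma sphere_delta0 n : sphere n (delta_mx 0 0 : 'rV[R]_n.+1).
Proof.
by apply/sphereP; rewrite trmx_delta mul_delta_mx; apply/matrixP => i j; rewrite !ord1 !mxE.
Qed.

(* The Householder reflection exchanging x and the first basis vector is an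
   orthogonal matrix with first row x; its other rows form the frame. *)
Lemma tangent_frame_exists n (x : 'rV[R]_n.+1) : sphere n x ->
  exists E, tangent_frame x E.
Proof.
move=> /sphereP xS; pose e : 'rV[R]_n.+1 := delta_mx 0 0; pose v := x - e.
have eS : e *m e^T = 1%:M by apply/sphereP/sphere_delta0.
(* If [x = e], then [s = 0] and the convention [2 / 0 = 0] makes [H] the identity, which still maps
   [e] to [x]. *)
pose s : R := (v *m v^T) 0 0; pose c := 2 / s.
pose H : 'M[R]_(1 + n) := 1%:M - c *: (v^T *m v).
have vv : v *m v^T = s%:M by rewrite [LHS]mx11_scalar.
have s0 : s = 0 -> v = 0.
  move=> s0; apply/eqP/negPn/negP => /sqr_sum_gt0.
  by rewrite -mulmx_tr_sqr -/s s0 ltxx.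
have HT : H^T = H by rewrite /H linearB linearZ /= tr_scalar_mx trmx_mul trmxK.
have HH : H *m H = 1%:M.
  have vvvv : (v^T *m v) *m (v^T *m v) = s *: (v^T *m v).
    by rewrite mulmxA -(mulmxA v^T) vv mul_mx_scalar -scalemxAl.
  rewrite /H; move: (v^T *m v) vvvv => W WW.
  rewrite mulmxBr mulmx1 mulmxBl mul1mx -scalemxAl -scalemxAr WW.
  rewrite -addrA -opprD !scalerA -scalerBl -scalerDl.
  have [s00|sN] := eqVneq s 0.
    by rewrite /c s00 invr0 !(mulr0, mul0r) subr0 addr0 scale0r subr0.
  by rewrite (_ : c + _ = 0) ?scale0r ?subr0// /c; field.
have xe : x *m e^T = e *m x^T.
  by rewrite -[LHS]trmx11 trmx_mul trmxK.
have eH : e *m H = x.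
  have [s00|sN] := eqVneq s 0.
    have /eqP := s0 s00; rewrite /v subr_eq0 => /eqP ->.
    by rewrite /H (s0 s00) mulmx0 scaler0 subr0 mulmx1.
  rewrite /H mulmxBr mulmx1 -scalemxAr mulmxA.
  (* Both vectors are unit, so [s = |x - e|^2 = 2 - 2 <x, e>], while [<e, v> = <x, e> - 1]. *)
  have -> : e *m v^T = (- s / 2)%:M.
    have : v *m v^T = - (2 *: (e *m v^T)).
      rewrite /v linearB /= mulmxBl !mulmxBr xS eS xe.
      by rewrite scaler_nat mulr2n -[X in X - _]opprB -opprD.
    rewrite vv => /(congr1 (fun z => - (2^-1 *: z))).
    rewrite scalerN opprK scalerA mulVf ?scale1r// => <-.
    by rewrite scale_scalar_mx -scaleN1r scale_scalar_mx; congr (_%:M); field.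
  rewrite mul_scalar_mx scalerA (_ : c * _ = -1) ?scaleN1r ?opprK /v; last by rewrite /c; field.
  by rewrite addrC subrK.
pose E : 'M[R]_(n, 1 + n) := dsubmx H; exists E.
have xE : x = usubmx H.
  by apply/rowP => j; rewrite -eH -rowE [LHS]mxE [RHS]mxE; congr (H _ _); apply: val_inj.
have := HH; rewrite -{2}HT -[H]vsubmxK tr_col_mx mul_col_row.
rewrite scalar_mx_block => /eq_block_mx[_ _ h3 h4].
by split; rewrite ?xE.
Qed.

Lemma quadratic_le_scale n (A : 'M[R]_n.+1) (l : R) :
  (forall y : 'rV[R]_n.+1, sphere n y -> (y *m A *m y^T) 0 0 <= l) ->
  forall y : 'rV[R]_n.+1, (y *m A *m y^T) 0 0 <= l * \sum_i y 0 i ^+ 2.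
Proof.
move=> Al y; have [->|y0] := eqVneq y 0.
  rewrite !mul0mx mxE big1 ?mulr0// => i _; by rewrite mxE expr0n.
have s0 := sqr_sum_gt0 y0; set s := \sum_i _ in s0 *.
pose r := Num.sqrt s; have r0 : 0 < r by rewrite sqrtr_gt0.
have rs : r ^+ 2 = s by rewrite sqr_sqrtr// ltW.
have zS : sphere n (r^-1 *: y).
  rewrite /sphere /=; under eq_bigr do rewrite mxE exprMn.
  by rewrite -mulr_sumr -/s exprVn rs mulVf// gt_eqF.
have := Al _ zS; rewrite linearZ /= -scalemxAr -!scalemxAl scalerA mxE.
by rewrite -expr2 exprVn rs ler_pdivrMl// mulrC.
Qed.

Lemma quadratic_sub_scale m (B : 'M[R]_m) (x w : 'rV[R]_m) (t : R) : B^T = B ->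
  ((x - t *: w) *m B *m (x - t *: w)^T) 0 0 =
  (x *m B *m x^T) 0 0 - 2 * t * (x *m B *m w^T) 0 0 + t ^+ 2 * (w *m B *m w^T) 0 0.
Proof.
move=> BT.
have wx : (w *m B *m x^T) 0 0 = (x *m B *m w^T) 0 0.
  by rewrite -[x *m B *m w^T]trmx11 !trmx_mul BT trmxK mulmxA.
have -> : (x - t *: w)^T = x^T - t *: w^T by apply/matrixP => i j; rewrite !mxE.
rewrite mulmxBl mulmxBr !mulmxBl -!scalemxAr -!scalemxAl.
rewrite !(mxE_sub, mxE_scale) wx; ring.
Qed.

(** Suppose [w = x B] is nonzero. At [x - t w] the form equals [t (t b - 2 a)] with [a = |w|^2 > 0]
    and [b >= 0], which is negative for small [t > 0]. *)
Lemma quadratic_nonneg_kernel m (B : 'M[R]_m) (x : 'rV[R]_m) : B^T = B ->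
  (forall y : 'rV[R]_m, 0 <= (y *m B *m y^T) 0 0) -> (x *m B *m x^T) 0 0 = 0 ->
  x *m B = 0.
Proof.
move=> BT Bge Bx; pose w := x *m B.
have xw : (x *m B *m w^T) 0 0 = \sum_i w 0 i ^+ 2 by rewrite -/w mulmx_tr_sqr.
apply/eqP/negPn/negP => /sqr_sum_gt0; rewrite -/w -xw.
set a := (x *m B *m w^T) 0 0 => a0.
set b := (w *m B *m w^T) 0 0.
have E t : (((x - t *: w) *m B) *m (x - t *: w)^T) 0 0 = t * (t * b - 2 * a).
  rewrite quadratic_sub_scale// Bx -/a -/b; ring.
have b0 : 0 <= b by exact: Bge.
(* The summand [1] keeps the denominator positive when [b = 0], and still [t b <= a < 2 a]. *)
pose t := a / (b + 1).
have := Bge (x - t *: w); rewrite E.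
have t0 : 0 < t by rewrite divr_gt0// ltr_wpDl.
rewrite pmulr_rge0// => h.
have : t * b <= a.
  by rewrite /t -mulrA ler_piMr ?(ltW a0)// mulrC ler_pdivrMr ?mul1r ?lerDl// ltr_wpDl.
lra.
Qed.

(** Rayleigh's principle: if the quadratic form attains its maximum [l] over the sphere at [x], then
    [l - A] is positive semidefinite and its form vanishes at [x], so [x] lies in its kernel. *)
Lemma symmetric_eigenvector n (A : 'M[R]_n.+1) : A^T = A ->
  exists2 x, sphere n x & exists l : R, x *m A = l *: x.
Proof.
move=> AT.
have [||x /set_mem xS xmax] := @compact_EVT_max _ R (fun y : 'rV[R]_n.+1 => (y *m A *m y^T) 0 0)
  (@sphere R n) _ (@sphere_compact n).
- by exists (delta_mx 0 0); exact: sphere_delta0.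
- by apply: continuous_subspaceT; exact: continuous_quadratic.
exists x => //; set l := (x *m A *m x^T) 0 0 in xmax; exists l.
have Al : forall y : 'rV[R]_n.+1, sphere n y -> (y *m A *m y^T) 0 0 <= l.
  by move=> y yS; apply: xmax; rewrite inE.
have Q (y : 'rV[R]_n.+1) : (y *m (l%:M - A) *m y^T) 0 0 =
    l * (\sum_i y 0 i ^+ 2) - (y *m A *m y^T) 0 0.
  by rewrite mulmxBr mul_mx_scalar mulmxBl -scalemxAl mxE_sub mxE_scale mulmx_tr_sqr.
have /eqP : x *m (l%:M - A) = 0.
  apply: quadratic_nonneg_kernel.
  - by rewrite linearB /= tr_scalar_mx AT.
  - by move=> y; rewrite Q subr_ge0; exact: quadratic_le_scale.
  - by rewrite Q xS mulr1 subrr.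
by rewrite mulmxBr mul_mx_scalar subr_eq0 => /eqP ->.
Qed.

(** Deflation by induction on the size: split off a unit eigenvector [x] and diagonalize the
    compression of [A] to its orthogonal complement, spanned by the frame [E]. *)
Lemma symmetric_eigvals n (A : 'M[R]_n) : A^T = A ->
  exists lam, eigvals_of A lam.
Proof.
elim: n A => [|n IH] A AT.
  by exists 0, 1%:M; split; apply/matrixP => -[].
have [x xS [l xA]] := symmetric_eigenvector AT.
have [E [EE Ex]] := tangent_frame_exists xS.
have [|lam [Q [QQ EA]]] := IH (E *m A *m E^T).
  by rewrite !trmx_mul trmxK AT mulmxA.
have xE : x *m E^T = 0 by rewrite -[LHS]trmxK trmx_mul trmxK Ex trmx0.
pose K : 'M[R]_(1 + n) := col_mx x E.
have KK : K *m K^T = 1%:M.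
  rewrite tr_col_mx mul_col_row EE Ex xE; have /sphereP -> := xS.
  by rewrite -scalar_mx_block.
have KK' : K^T *m K = 1%:M by exact: mulmx1C.
pose W : 'M[R]_(1 + n) := block_mx 1%:M 0 0 Q.
have WW : W *m W^T = 1%:M.
  by rewrite tr_block_mx mulmx_block !(trmx0, trmx1, mulmx0, mul0mx, mulmx1, addr0, add0r) QQ -scalar_mx_block.
exists (row_mx l%:M lam : 'rV[R]_(1 + n)), (W *m K); split.
  by rewrite trmx_mul mulmxA -(mulmxA W) KK mulmx1.
(* Since [x] is an eigenvector and [A] is symmetric, the blocks coupling [x] with its complement
   vanish. *)
have KA : K *m A *m K^T = block_mx l%:M 0 0 (E *m A *m E^T).
  have xAE : x *m A *m E^T = 0 by rewrite xA -scalemxAl xE scaler0.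
  have EAx : E *m A *m x^T = 0.
    by have := congr1 trmx xAE; rewrite !trmx_mul trmxK AT trmx0 mulmxA.
  rewrite tr_col_mx mul_col_mx mul_col_row xAE EAx xA -scalemxAl.
  by have /sphereP -> := xS; rewrite scale_scalar_mx mulr1.
have -> : A = K^T *m (K *m A *m K^T) *m K.
  by rewrite !mulmxA KK' mul1mx -mulmxA KK' mulmx1.
have D : block_mx l%:M 0 0 (E *m A *m E^T) =
    W^T *m diag_mx (row_mx l%:M lam) *m W.
  rewrite EA diag_mx_row tr_block_mx !mulmx_block.
  rewrite !(trmx0, trmx1, mulmx0, mul0mx, mulmx1, mul1mx, addr0, add0r).
  by congr block_mx; apply/matrixP => i j; rewrite !ord1 !mxE.
by rewrite KA D trmx_mul !mulmxA.
Qed.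

End RealSpectral.

(** * Second-order conditions at extrema and symmetry of the Hessian *)

Section SecondOrder.
Set Implicit Arguments. Unset Strict Implicit.
Context {R : realType}.

Lemma is_derive_line (V : normedModType R) (f : V -> R) (y v : V) (t : R) :
  derivable f (y + t *: v) v ->
  is_derive t 1 (fun s => f (y + s *: v)) ('D_v f (y + t *: v)).
Proof.
move=> df; have E : (fun h : R => h^-1 *: (((fun s => f (y + s *: v)) \o shift t) (h *: 1)
      - f (y + t *: v))) =
    (fun h => h^-1 *: ((f \o shift (y + t *: v)) (h *: v) - f (y + t *: v))).
  apply/funext => h /=; congr (_ *: (f _ - _)).
  by rewrite [h *: 1]mulr1 scalerDl addrCA.
by apply: DeriveDef; [rewrite /derivable E | rewrite /derive E].
Qed.

(** Fermat's rule gives [g1 0 = 0]. If [L > 0], then [g1] is positive just to the right of [0], and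
    the mean value theorem produces [t > 0] with [g t > g 0]. *)
Lemma second_derivative_test_max (g g1 : R -> R) (L : R) :
  (\forall t \near (0 : R), is_derive (t : R) (1 : R) g (g1 t)) ->
  is_derive (0 : R) (1 : R) g1 L ->
  (\forall t \near (0 : R), g t <= g 0) -> g1 0 = 0 /\ L <= 0.
Proof.
move=> dg dg1 gmax.
have [e e0 he] : exists2 e : R, 0 < e & forall t, `|t| < e ->
    is_derive (t : R) (1 : R) g (g1 t) /\ g t <= g 0.
  have : \forall t \near (0 : R), is_derive (t : R) (1 : R) g (g1 t) /\ g t <= g 0.
    by near=> t; split; near: t.
  move=> /nbhs_ballP[e /= e0 he]; exists e => // t te; apply: he.
  by rewrite /ball /= sub0r normrN.
have he' t : t \in `](- e), e[ -> is_derive (t : R) (1 : R) g (g1 t) /\ g t <= g 0.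
  by rewrite in_itv /= -ltr_norml; exact: he.
have g10 : g1 0 = 0.
  have [|d0 _] := he 0; first by rewrite normr0.
  have : is_derive (0 : R) (1 : R) g 0.
    apply: (@derive1_at_max _ g (- e) e) => [|t /he'[]//||t /he'[]//].
    - lra.
    - by rewrite in_itv /= oppr_lt0 e0.
  by case: d0 => _ <-; case=> _ ->.
split=> //; rewrite leNgt; apply/negP => L0.
have [d d0 hd] : exists2 d : R, 0 < d & forall t, 0 < t < d -> 0 < g1 t.
  have : h^-1 *: ((g1 \o shift 0) (h *: 1) - g1 0) @[h --> 0^'] --> L.
    by case: dg1 => + <-.
  move=> /cvgrPdist_lt /(_ L L0) /nbhs_ballP[d /= d0 hd]; exists d => // t /andP[t0 td].
  have := hd t; rewrite /ball /= sub0r normrN gtr0_norm// => /(_ td).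
  rewrite gt_eqF// => /(_ isT); rewrite g10 subr0 [t *: 1]mulr1 addr0 => h.
  have : 0 < t^-1 * g1 t by move: h; rewrite ltr_norml => /andP[_]; rewrite /GRing.scale /=; lra.
  by rewrite pmulr_rgt0 // invr_gt0.
pose t := Num.min d e / 2.
have m0 : 0 < Num.min d e by rewrite lt_min d0 e0.
have t0 : 0 < t by rewrite divr_gt0.
have [td te] : t < d /\ t < e.
  have : Num.min d e <= d by rewrite ge_min lexx.
  have : Num.min d e <= e by rewrite ge_min lexx orbT.
  rewrite /t; lra.
have dgI s : s \in `[0, t] -> is_derive s 1 g (g1 s).
  by rewrite in_itv /= => /andP[s0 st]; apply: (he s _).1; rewrite ger0_norm//; lra.
have [|c] := @MVT _ g g1 0 t t0 (fun s sI => dgI s (subset_itv_oo_cc sI)).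
  by apply: derivable_within_continuous => s /dgI[].
rewrite in_itv /= => /andP[c0 ct] E.
have gc : 0 < g1 c by apply: hd; rewrite c0 (lt_trans ct).
have gt : g t <= g 0 by apply: (he t _).2; rewrite gtr0_norm.
nra.
Unshelve. all: by end_near.
Qed.

Lemma derive_partial m (f : 'rV[R]_m -> R) (y v : 'rV[R]_m) :
  differentiable f y -> 'D_v f y = \sum_i v 0 i * partial f i y.
Proof.
move=> df; rewrite deriveE// {1}[v]row_sum_delta linear_sum /=.
by apply: eq_bigr => i _; rewrite linearZ /= /partial deriveE.
Qed.

(** The factor [s] treats maxima ([s > 0]) and minima ([s < 0]) at once. Restriction to the lines
    [x + t v] reduces the claim to the one-variable test; basis vectors [v] give the gradient. *)
Lemma egrad_ehess_extremum m (f : 'rV[R]_m -> R) (x : 'rV[R]_m) (s : R) :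
  s != 0 ->
  (\forall y \near x, differentiable f y) ->
  (forall i, differentiable (partial f i) x) ->
  (\forall y \near x, s * f y <= s * f x) ->
  egrad f x = 0 /\ forall v : 'rV[R]_m, s * (v *m ehess f x *m v^T) 0 0 <= 0.
Proof.
move=> s0 df ddf fmax.
have line (v : 'rV[R]_m) :
    s * 'D_v f x = 0 /\ s * (v *m ehess f x *m v^T) 0 0 <= 0.
  have cv : (x + t *: v) @[t --> (0 : R)] --> x.
    rewrite -[X in _ --> X]addr0 -[X in _ + X](scale0r v).
    by apply: cvgD; [exact: cvg_cst | apply: cvgZr_tmp; exact: cvg_id].
  pose g t := s * f (x + t *: v).
  pose g1 t := s * \sum_i v 0 i * partial f i (x + t *: v).
  have x0v : x + 0 *: v = x by rewrite scale0r addr0.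
  have [|||E1 E2] := @second_derivative_test_max g g1 (s * (v *m ehess f x *m v^T) 0 0).
  - near=> t; have dt : differentiable f (x + t *: v).
      by near: t; apply: (cv _ df).
    rewrite /g1 -derive_partial//.
    by apply: is_deriveZ; apply/is_derive_line/diff_derivable.
  - have -> : (v *m ehess f x *m v^T) 0 0 =
        \sum_i v 0 i * 'D_v (partial f i) (x + 0 *: v).
      rewrite x0v -mulmxA mxE; apply: eq_bigr => i _; congr (_ * _).
      by rewrite derive_partial// mxE; apply: eq_bigr => j _; rewrite !mxE mulrC.
    apply: is_deriveZ.
    rewrite (_ : (fun _ => _) =
        \sum_i (v 0 i *: (fun t : R => partial f i (x + t *: v)))); last first.
      by apply/funext => t; rewrite fct_sumE.
    apply: is_derive_sum => i; apply: is_deriveZ; apply: is_derive_line.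
    by rewrite x0v; exact: diff_derivable.
  - by near=> t; rewrite /g x0v; near: t; apply: (cv _ fmax).
  - split=> //; rewrite derive_partial; last exact: nbhs_singleton df.
    by move: E1; rewrite /g1 x0v.
split; last by move=> v; exact: (line v).2.
apply/rowP => i; rewrite !mxE; apply/eqP.
by have /eqP := (line (ebase R i)).1; rewrite mulf_eq0 (negbTE s0).
Unshelve. all: by end_near.
Qed.

(** The mean value theorem is applied twice: in direction [i] to the increment of [f] across
    [t e_j], then in direction [j] to [partial f i]. *)
Lemma mean_value_second_difference m (f : 'rV[R]_m -> R) (x : 'rV[R]_m)
    (i j : 'I_m) (t : R) : 0 < t ->
  (forall a b, 0 <= a <= t -> 0 <= b <= t ->
     differentiable f (x + a *: ebase R i + b *: ebase R j) /\
     differentiable (partial f i) (x + a *: ebase R i + b *: ebase R j)) ->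
  exists a b, [/\ 0 <= a <= t, 0 <= b <= t &
    f (x + t *: ebase R i + t *: ebase R j) - f (x + t *: ebase R i)
    - (f (x + t *: ebase R j) - f x) =
    partial (partial f i) j (x + a *: ebase R i + b *: ebase R j) * t * t].
Proof.
move=> t0 df; set ei := ebase R i; set ej := ebase R j.
have tI : 0 <= t <= t by rewrite lexx ltW.
have zI : (0 : R) <= 0 <= t by rewrite lexx ltW.
pose g s := f (x + t *: ej + s *: ei) - f (x + s *: ei).
pose dg s := partial f i (x + t *: ej + s *: ei) - partial f i (x + s *: ei).
have gd s : 0 <= s <= t -> is_derive s (1 : R) g (dg s).
  move=> sI; apply: is_deriveB; apply: is_derive_line; apply: diff_derivable.
    by rewrite addrAC; exact: (df s t sI tI).1.
  by have := (df s 0 sI zI).1; rewrite scale0r addr0.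
have [s||a] := @MVT _ g dg 0 t t0.
- by rewrite in_itv /= => /andP[s0 st]; apply: gd; rewrite !ltW.
- by apply: derivable_within_continuous => s; rewrite in_itv /= => /gd[].
rewrite in_itv /= => /andP[a0 ta]; rewrite subr0 => Ea.
have aI : 0 <= a <= t by rewrite !ltW.
pose h s := partial f i (x + a *: ei + s *: ej).
have hd s : 0 <= s <= t ->
    is_derive s (1 : R) h (partial (partial f i) j (x + a *: ei + s *: ej)).
  by move=> sI; apply: is_derive_line; apply: diff_derivable; exact: (df a s aI sI).2.
have [s||b] := @MVT _ h (fun s => partial (partial f i) j (x + a *: ei + s *: ej)) 0 t t0.
- by rewrite in_itv /= => /andP[s0 st]; apply: hd; rewrite !ltW.
- by apply: derivable_within_continuous => s; rewrite in_itv /= => /hd[].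
rewrite in_itv /= => /andP[b0 tb]; rewrite subr0 => Eb.
exists a, b; split; rewrite ?(ltW a0) ?(ltW ta) ?(ltW b0) ?(ltW tb)//.
have hdg : h t - h 0 = dg a by rewrite /h /dg scale0r addr0 (addrAC x (t *: ej)).
by rewrite -Eb hdg -Ea /g scale0r !addr0 (addrAC x (t *: ej)).
Qed.

(** Schwarz's theorem: the second difference is symmetric in [i] and [j], so the two mixed partials,
    each taken at a suitable point near [x], agree; continuity transfers this to [x]. *)
Lemma ehess_sym m (f : 'rV[R]_m -> R) (x : 'rV[R]_m) :
  (\forall y \near x, differentiable f y) ->
  (forall i, \forall y \near x, differentiable (partial f i) y) ->
  (forall i j, {for x, continuous (partial (partial f i) j)}) ->
  (ehess f x)^T = ehess f x.
Proof.
have close (e A B C D : R) : C = D -> `|A - C| < e / 2 -> `|B - D| < e / 2 ->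
    `|A - B| <= e.
  move=> ->; rewrite !ltr_norml ler_norml => /andP[? ?] /andP[? ?].
  by apply/andP; split; lra.
move=> df ddf cf; apply/matrixP => j i; rewrite !mxE.
apply/eqP; rewrite -subr_eq0 -normr_le0; apply/ler_addgt0Pl => e e0; rewrite addr0.
have e2 : 0 < e / 2 by rewrite divr_gt0.
set ei := ebase R i; set ej := ebase R j.
pose proof ((cvgrPdist_lt _ _).1 (cf i j) _ e2) as ci.
pose proof ((cvgrPdist_lt _ _).1 (cf j i) _ e2) as cj.
pose proof (filterI df (filterI (ddf i) (filterI (ddf j) (filterI ci cj)))) as F.
have {F} /nbhs_ballP[r /= r0 hr] := F.
(* With [t = r / K] the square spanned by [t e_i] and [t e_j] at [x] lies in the open ball of radius
   [r]; the summand [1] makes the inequality strict. *)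
pose K := `|ei| + `|ej| + 1; have K0 : 0 < K by rewrite ltr_wpDl// addr_ge0.
pose t := r / K; have t0 : 0 < t by rewrite divr_gt0.
have inball a b : 0 <= a <= t -> 0 <= b <= t -> ball x r (x + a *: ei + b *: ej).
  move=> /andP[a0 ta] /andP[b0 tb]; rewrite -ball_normE /= -addrA opprD addrA subrr sub0r.
  rewrite normrN (le_lt_trans (ler_normD _ _))// !normrZ !ger0_norm//.
  have -> : r = t * K by rewrite /t divfK// gt_eqF.
  have := ler_wpM2r (normr_ge0 ei) ta; have := ler_wpM2r (normr_ge0 ej) tb.
  rewrite /K !mulrDr mulr1; lra.
have inball' a b : 0 <= a <= t -> 0 <= b <= t -> ball x r (x + a *: ej + b *: ei).
  by move=> aI bI; rewrite addrAC; exact: inball.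
have [a [b [aI bI E1]]] := @mean_value_second_difference _ f x i j t t0
  (fun a b aI bI => let: conj p (conj q _) := hr _ (inball a b aI bI) in conj p q).
have [c [d [cI dI E2]]] := @mean_value_second_difference _ f x j i t t0
  (fun a b aI bI => let: conj p (conj _ (conj q _)) := hr _ (inball' a b aI bI) in conj p q).
have E : partial (partial f i) j (x + a *: ei + b *: ej) =
         partial (partial f j) i (x + c *: ej + d *: ei).
  apply: (mulIf (lt0r_neq0 t0)); apply: (mulIf (lt0r_neq0 t0)).
  apply: etrans (esym E1) _; apply: etrans _ E2.
  rewrite (addrAC x (t *: ebase R j)).
  have swap (A B C D : R) : A - B - (C - D) = A - C - (B - D) by ring.
  exact: swap.
have [_ [_ [_ [h1 _]]]] := hr _ (inball _ _ aI bI).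
have [_ [_ [_ [_ h2]]]] := hr _ (inball' _ _ cI dI).
exact: close E h1 h2.
Qed.

End SecondOrder.

(** * Extrema on the sphere through the degree-zero extension *)

Section SphereExtrema.
Set Implicit Arguments. Unset Strict Implicit.
Context {R : realType}.

Lemma ext0_sphere n (u : 'rV[R]_n.+1 -> R) x : sphere n x -> ext0 u x = u x.
Proof. by move=> xS; rewrite /ext0 /enorm xS sqrtr1 invr1 scale1r. Qed.

Lemma sphere_normalize n (y : 'rV[R]_n.+1) : y != 0 ->
  sphere n ((enorm y)^-1 *: y).
Proof.
move=> y0; have s0 := sqr_sum_gt0 y0.
rewrite /sphere /=; under eq_bigr do rewrite mxE exprMn.
by rewrite -mulr_sumr exprVn sqr_sqrtr ?(ltW s0)// mulVf// gt_eqF.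
Qed.

Lemma sphere_neq0 n (x : 'rV[R]_n.+1) : sphere n x -> x != 0.
Proof.
move=> /sphereP xx; apply: contra_eq_neq xx => ->.
rewrite mul0mx; apply/eqP => /matrixP/(_ 0 0); rewrite !mxE => /eqP.
by rewrite eq_sym oner_eq0.
Qed.

Lemma near_neq0 (V : normedModType R) (x : V) : x != 0 -> \forall y \near x, y != 0.
Proof.
move=> x0; apply/nbhs_ballP; exists `|x|; first by rewrite /= normr_gt0.
move=> y; rewrite -ball_normE /=; apply: contraTneq => ->.
by rewrite subr0 ltxx.
Qed.

(** [Q A Q^T] is diagonal: the rows of [Q] are unit eigenvectors, on which the quadratic form takes
    the eigenvalues. *)
Lemma eigvals_quadratic n (A Q : 'M[R]_n) (lam : 'rV[R]_n) i :
  Q *m Q^T = 1%:M -> A = Q^T *m diag_mx lam *m Q ->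
  (row i Q *m A *m (row i Q)^T) 0 0 = lam 0 i.
Proof.
move=> QQ AE; have D : Q *m A *m Q^T = diag_mx lam.
  by rewrite AE !mulmxA QQ mul1mx -mulmxA QQ mulmx1.
have -> : lam 0 i = (Q *m A *m Q^T) i i by rewrite D mxE eqxx mulr1n.
rewrite -row_mul; move: (Q *m A) => M.
by rewrite mxE [RHS]mxE; apply: eq_bigr => k _; rewrite !mxE.
Qed.

(** At each [y != 0] the extension [ext0 u] takes a value of [u] on the sphere. An extremum on the
    sphere is thus an unconstrained local extremum of [ext0 u], and the Euclidean test applies. *)
Lemma sphere_extremum n (u : 'rV[R]_n.+1 -> R) x (s : R) : s != 0 ->
  C2_sphere u -> sphere n x ->
  (forall y, sphere n y -> s * u y <= s * u x) ->
  exists E lam, [/\ tangent_frame x E, eigvals_of (shess u x E + (u x)%:M) lam,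
    sgrad u x E = 0 & forall i, s * lam 0 i <= s * u x].
Proof.
move=> s0 uC2 xS umax; have x0 := sphere_neq0 xS.
have dF : \forall y \near x, differentiable (ext0 u) y.
  by apply: filterS (near_neq0 x0) => y /uC2[].
have ddF i : \forall y \near x, differentiable (partial (ext0 u) i) y.
  by apply: filterS (near_neq0 x0) => y /uC2[].
have Fmax : \forall y \near x, s * ext0 u y <= s * ext0 u x.
  apply: filterS (near_neq0 x0) => y y0; rewrite (ext0_sphere u xS).
  exact/umax/sphere_normalize.
have [_ _ cF] := uC2 x x0.
have Hsym := ehess_sym dF ddF cF.
have [gr0 Hle] := egrad_ehess_extremum s0 dF (fun i => nbhs_singleton (ddF i)) Fmax.
have [E EF] := tangent_frame_exists xS; exists E.
have [|lam lamE] := @symmetric_eigvals R _ (shess u x E + (u x)%:M).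
  by rewrite linearD /= tr_scalar_mx /shess !trmx_mul trmxK Hsym mulmxA.
exists lam; split=> //; first by rewrite /sgrad gr0 mul0mx.
move=> i; have [Q [QQ AE]] := lamE; rewrite -(eigvals_quadratic i QQ AE).
(* The eigenvalue splits into the Euclidean Hessian form at the vector [(row i Q) E] plus [u x]; the
   first term times [s] is nonpositive. *)
rewrite mulmxDr mulmxDl mul_mx_scalar -scalemxAl.
have -> : row i Q *m (row i Q)^T = 1%:M.
  rewrite [LHS]mx11_scalar; congr (_%:M).
  transitivity ((Q *m Q^T) i i); last by rewrite QQ mxE eqxx.
  by rewrite mxE [RHS]mxE; apply: eq_bigr => k _; rewrite !mxE.
have -> : row i Q *m shess u x E *m (row i Q)^T =
    (row i Q *m E) *m ehess (ext0 u) x *m (row i Q *m E)^T.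
  by rewrite /shess trmx_mul !mulmxA.
rewrite mxE [X in _ + X]mxE [1%:M _ _]mxE mulr1 mulrDr.
by rewrite gerDr Hle.
Qed.

Lemma LambdaI_extremum n P (lam : 'rV[R]_n) (s c : R) I : I \in Pindices n P ->
  (forall i, s * lam 0 i <= s * c) -> s * LambdaI lam I <= s * (P%:R * c).
Proof.
rewrite inE => /eqP IP lc; rewrite /LambdaI mulr_sumr mulrCA -IP mulr_natl.
by rewrite -sumr_const; apply: ler_sum.
Qed.

(** With [p = q - l] the exponents add up: [(p - 1 + eps) + (k + 1 - q) = k - l + eps]. *)
Lemma powR_rhs (u p q eps : R) (k l : nat) : 0 < u -> (l < k)%N -> p = q - l%:R ->
  u `^ (p - 1 + eps) * (u ^+ 2) `^ ((k%:R + 1 - q) / 2) = u ^+ (k - l) * u `^ eps.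
Proof.
move=> u0 lk ->; rewrite -(powR_mulrn _ (ltW u0)) -powRrM.
rewrite -(powR_mulrn _ (ltW u0)) -!powRD ?(gt_eqF u0) ?implybT//.
by congr (_ `^ _); rewrite natrB ?(ltnW lk)//; field.
Qed.

End SphereExtrema.

(** * Comparison at the minimum and maximum points of [u] *)

Theorem theorem5p1 (R : realType) (n P k l : nat) (p q eps : R)
  (phi u : 'rV[R]_(n.+1) -> R) :
  (2 <= n)%N -> (1 < P)%N -> (P <= n - 1)%N ->
  (l < k)%N -> (k <= 'C(n, P))%N ->
  p = q - l%:R -> 1 < p -> 0 < eps ->
  {within sphere n, continuous phi} ->
  (forall x, sphere n x -> 0 < phi x) ->
  C2_sphere u ->
  (forall x, sphere n x -> 0 < u x) ->
  admissible n P k u ->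
  (forall x, sphere n x -> forall E, tangent_frame x E ->
     forall lam, eigvals_of (shess u x E + (u x)%:M) lam ->
       sigmaL P k lam / sigmaL P l lam =
       u x `^ (p - 1 + eps)
       * (u x ^+ 2 + \sum_a (sgrad u x E) 0 a ^+ 2) `^ ((k%:R + 1 - q) / 2)
       * phi x) ->
  forall x, sphere n x ->
    ('C('C(n, P), k)%:R / 'C('C(n, P), l)%:R) * P%:R ^+ (k - l)
      / sup [set phi y | y in sphere n] <= u x `^ eps /\
    u x `^ eps <=
    ('C('C(n, P), k)%:R / 'C('C(n, P), l)%:R) * P%:R ^+ (k - l)
      / inf [set phi y | y in sphere n].
Proof.
move=> _ _ _ lk kN pq _ eps0 cphi phi0 uC2 u0 uadm ueq x xS.
set K := _ * P%:R ^+ _.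
have sph0 : @sphere R n !=set0 by exists x.
(* On the sphere [u] agrees with [ext0 u], which is differentiable off the origin. *)
have cu : {within sphere n, continuous u}.
  apply: (@subspace_eq_continuous _ _ _ (ext0 u)).
    by move=> y /set_mem yS; exact: ext0_sphere.
  apply: continuous_in_subspaceT => y /set_mem yS.
  by have [/differentiable_continuous] := uC2 y (sphere_neq0 yS).
have cardP : #|Pindices n P| = 'C(n, P).
  by rewrite /Pindices card_draws card_ord.
have rhs y E : sphere n y -> sgrad u y E = 0 ->
    u y `^ (p - 1 + eps)
    * (u y ^+ 2 + \sum_a (sgrad u y E) 0 a ^+ 2) `^ ((k%:R + 1 - q) / 2)
    * phi y = u y ^+ (k - l) * (u y `^ eps * phi y).
  move=> yS ->; rewrite big1 ?addr0; last by move=> a _; rewrite mxE expr0n.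
  by rewrite (powR_rhs _ (u0 y yS) lk pq) mulrA.
have Kc y : K * u y ^+ (k - l) =
    'C(#|Pindices n P|, k)%:R / 'C(#|Pindices n P|, l)%:R * (P%:R * u y) ^+ (k - l).
  by rewrite cardP exprMn mulrA.
have upow0 y : sphere n y -> 0 < u y ^+ (k - l) by move=> yS; rewrite exprn_gt0 ?u0.
have powu y z : sphere n y -> u y <= u z -> u y `^ eps <= u z `^ eps.
  by move=> yS yz; apply: ge0_ler_powR; rewrite ?nnegrE ?(ltW eps0) ?(ltW (u0 y yS)) ?(le_trans (ltW (u0 y yS))).
(* Compactness bounds [phi], so [sup] and [inf] are true bounds and not default values; [inf] is
   positive because [phi] attains its minimum. *)
have phi_ub : has_ubound [set phi y | y in sphere n].
  have [c _ cmax] := compact_EVT_max sph0 (@sphere_compact R n) cphi.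
  by exists (phi c) => _ [y yS <-]; apply: cmax; rewrite inE.
have [a /set_mem aS amin] := compact_EVT_min sph0 (@sphere_compact R n) cphi.
have phi_lb : has_lbound [set phi y | y in sphere n].
  by exists (phi a) => _ [y yS <-]; apply: amin; rewrite inE.
have inf0 : 0 < inf [set phi y | y in sphere n].
  apply: lt_le_trans (phi0 a aS) _; apply: lb_le_inf; first by exists (phi x), x.
  by move=> _ [y yS <-]; apply: amin; rewrite inE.
have kP : (k <= #|Pindices n P|)%N by rewrite cardP.
have Pu0 y : sphere n y -> 0 <= P%:R * u y.
  by move=> yS; rewrite mulr_ge0// ltW// u0.
split.
(* Lower bound, at a minimum point [m]: every [Lambda_I] is at least [P u(m)], and cancelling
   [u(m)^(k - l)] gives [K <= u(m)^eps phi(m) <= u(x)^eps sup phi]. *)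
- have [m /set_mem mS mmin] := compact_EVT_min sph0 (@sphere_compact R n) cu.
  have [||E [lam [EF lamE g0 lamle]]] := @sphere_extremum R n u m (-1) _ uC2 mS.
  + by rewrite oppr_eq0 oner_eq0.
  + by move=> y yS; rewrite !mulN1r lerN2; apply: mmin; rewrite inE.
  (* Membership in [Gamma_k] concerns the orders [1] to [k]; order [0] is the constant [1]. *)
  have sl0 : 0 < sigmaL P l lam.
    case: (l) (ltnW lk) => [|l'] l'k; first by rewrite /sigmaL sigma_0.
    exact: (uadm m mS E EF lam lamE).
  have LamP I : I \in Pindices n P -> P%:R * u m <= LambdaI lam I.
    by move=> IP; have := LambdaI_extremum IP lamle; rewrite !mulN1r lerN2.
  have := sigma_quotient_ge (Pu0 m mS) lk kP LamP sl0.
  have e := ueq m mS E EF lam lamE; rewrite rhs// in e; rewrite [X in _ <= X]e.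
  rewrite -Kc [K * _]mulrC (ler_pM2l (upow0 m mS)) => h.
  have sup_ge : phi m <= sup [set phi y | y in sphere n].
    by apply: ub_le_sup => //; exists m.
  have um : u m `^ eps <= u x `^ eps by apply: powu => //; apply: mmin; rewrite inE.
  rewrite ler_pdivrMr; last exact: lt_le_trans (phi0 m mS) sup_ge.
  apply: le_trans h _; apply: ler_pM um sup_ge; first exact: powR_ge0.
  exact/ltW/phi0.
(* Upper bound, at a maximum point [m]: entries may be negative here, and admissibility supplies the
   positivity behind the quotient estimate. The chain is
   [u(x)^eps inf phi <= u(m)^eps phi(m) <= K]. *)
- have [m /set_mem mS mmax] := compact_EVT_max sph0 (@sphere_compact R n) cu.
  have [||E [lam [EF lamE g0 lamle]]] := @sphere_extremum R n u m 1 _ uC2 mS.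
  + exact: oner_neq0.
  + by move=> y yS; rewrite !mul1r; apply: mmax; rewrite inE.
  have LamP I : I \in Pindices n P -> LambdaI lam I <= P%:R * u m.
    by move=> IP; have := LambdaI_extremum IP lamle; rewrite !mul1r.
  have := sigma_quotient_le (Pu0 m mS) lk kP LamP (uadm m mS E EF lam lamE).
  have e := ueq m mS E EF lam lamE; rewrite rhs// in e; rewrite [X in X <= _]e.
  rewrite -Kc [K * _]mulrC (ler_pM2l (upow0 m mS)) => h.
  have inf_le : inf [set phi y | y in sphere n] <= phi m.
    by apply: ge_inf => //; exists m.
  have um : u x `^ eps <= u m `^ eps by apply: powu => //; apply: mmax; rewrite inE.
  rewrite ler_pdivlMr//; apply: le_trans _ h.
  by apply: ler_pM um inf_le; [exact: powR_ge0 | exact: ltW].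
Qed.
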